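(* Let $(\Omega,\Sigma)$ be a measurable space, $\{E_\theta\}_{\theta\in\Theta}\subseteq\Sigma$ a regular chain, $\mathcal Z=\prod_{i=1}^n\mathcal Z_i$ a finite product of measurable spaces, and $\{\mu_z\}_{z\in\mathcal Z}$ a family in $\mathrm{ca}(\Omega,\Sigma)$ that is order bounded from below, satisfies $\|\mu_z\|\le1$ for all $z\in\mathcal Z$, and is such that $z\mapsto\mu_z(E_\theta)$ is measurable for each $\theta\in\Theta$. Let $Z$ be a random vector in $\mathcal Z$ with independent components, let $F_Z(\theta):=\mu_Z(E_\theta)$, and let $\nu:=\bigwedge_{z\in\mathcal Z}\mu_z$. If $1<\eta_F<\infty$, then for all $\varepsilon>0$, $$\mathbb P\left\{\frac{\sqrt{\eta_F}}{\mathcal R\big((1+\|\nu\|)^2\eta_F\big)}\ \sup_{\theta\in\Theta}|F_Z(\theta)-\mathbb E[F_Z(\theta)]|\ge\varepsilon\right\}\le 2\mathrm e^{-2\varepsilon^2},$$ where $$\mathcal R(x):=\sqrt{\log_4 x}+2\min\left\{1,\ \frac{\ln(\mathrm e+\ln x)}{\sqrt{\ln x}}\right\},\qquad x>1.$$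
   Context: **Effective sample size.** For a bounded function $F\colon\mathcal Z\times\Theta\to\mathbb R$ (here $F(z,\theta)=\mu_z(E_\theta)$, $\Theta$ non-empty), put $c_i(F):=\sup_{\theta\in\Theta,\,z_i^*\in\mathcal Z_i,\,z\in\mathcal Z}|F(z_i^*,z_{-i},\theta)-F(z,\theta)|$, where $(z_i^*,z_{-i})$ is $z$ with its $i$-th coordinate replaced by $z_i^*$, and $\eta_F:=(\sum_{i=1}^n c_i(F)^2)^{-1}\in(0,\infty]$ (with $1/0=\infty$). **Regular chain.** An indexed family $\{E_\theta\}_{\theta\in\Theta}\subseteq\Sigma$ is a regular chain if (1) for all $\theta,\theta^*\in\Theta$ either $E_\theta\subseteq E_{\theta^*}$ or $E_{\theta^*}\subseteq E_\theta$; and (2) there is a positive, finite, finitely additive measure $\lambda$ on $(\Omega,\Sigma)$ such that $\theta\neq\theta^*$ implies $\lambda(E_\theta\triangle E_{\theta^*})>0$. **Signed measures.** $\mathrm{ca}(\Omega,\Sigma)$ is the Dedekind complete Banach lattice of finite countably additive signed measures on $(\Omega,\Sigma)$ with total variation norm $\|\cdot\|$ and setwise order; $\bigwedge$ denotes the infimum in this lattice. Order bounded from below means there is $\kappa\in\mathrm{ca}(\Omega,\Sigma)$ with $\kappa\le\mu_z$ for all $z$. $\log_4 x=\ln x/\ln4$. *)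

(* Defs.v *)
From mathcomp Require Import all_boot all_order all_algebra.
From mathcomp Require Import all_classical all_reals all_analysis.

Set Implicit Arguments.
Unset Strict Implicit.
Unset Printing Implicit Defensive.

Import Order.TTheory GRing.Theory Num.Theory.
Import numFieldNormedType.Exports.

Local Open Scope classical_set_scope.
Local Open Scope ring_scope.

(* Elements of ca(Omega, Sigma) are the library's charges.  A charge is a
   function on all subsets, but only its values on measurable sets matter, so
   the setwise order is tested on measurable sets only. *)
Section charges.
Context {d : measure_display} {T : measurableType d} {R : realType}.

Definition charge_le (nu mu : {charge set T -> \bar R}) : Prop :=
  forall A, measurable A -> (nu A <= mu A)%E.

Definition charge_lower_bound (I : Type) (mu : I -> {charge set T -> \bar R})
    (kappa : {charge set T -> \bar R}) : Prop :=
  forall i, charge_le kappa (mu i).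

Definition order_bounded_below (I : Type)
    (mu : I -> {charge set T -> \bar R}) : Prop :=
  exists kappa, charge_lower_bound mu kappa.

Definition is_charge_inf (I : Type) (mu : I -> {charge set T -> \bar R})
    (nu : {charge set T -> \bar R}) : Prop :=
  charge_lower_bound mu nu /\
  forall kappa, charge_lower_bound mu kappa -> charge_le kappa nu.

Lemma Hahn_decomposition_pair (nu : {charge set T -> \bar R}) :
  exists PN : set T * set T, hahn_decomposition nu PN.1 PN.2.
Proof. by have [P [N PN]] := Hahn_decomposition nu; exists (P, N). Qed.

(* |nu|(T), computed from some Hahn decomposition; by [tv_normE] the choice is
   irrelevant. *)
Definition tv_norm (nu : {charge set T -> \bar R}) : R :=
  fine (charge_variation (projT2 (cid (Hahn_decomposition_pair nu))) setT).

Lemma tv_normE (nu : {charge set T -> \bar R}) (P N : set T)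
    (nuPN : hahn_decomposition nu P N) :
  tv_norm nu = fine (charge_variation nuPN setT).
Proof.
rewrite /tv_norm; case: cid => -[P' N'] /= nuPN'.
have [hP hN] := Hahn_decomposition_uniq nuPN' nuPN measurableT.
rewrite /charge_variation !jordan_posE !cjordan_posE !jordan_negE !cjordan_negE.
by rewrite /crestr0 !mem_set //= /crestr hP hN.
Qed.

(* Contents are the nonnegative finitely additive set functions. *)
Definition regular_chain (Theta : Type) (E : Theta -> set T) : Prop :=
  [/\ forall t, measurable (E t),
      forall t u, E t `<=` E u \/ E u `<=` E t
    & exists lambda : {content set T -> \bar R},
        (lambda setT < +oo)%E /\
        forall t u, t <> u -> (0 < lambda (E t `+` E u))%E].

End charges.
Arguments regular_chain {d T} R {Theta} E.

(* The product of finitely many, possibly different, measurable spaces: the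
   dependent functions with the sigma-algebra generated by the projections. *)
Section products.
Context {n : nat} {dZ : 'I_n -> measure_display}.
Variable Z : forall i, measurableType (dZ i).

Definition cylinders : set (set (forall i, Z i)) :=
  \bigcup_(i in [set: 'I_n])
    preimage_set_system setT (fun z : forall i, Z i => z i) measurable.

Definition prod_space := g_sigma_algebraType cylinders.

Definition independent_components {d : measure_display} {S : measurableType d}
    {R : realType} (P : probability S R) (X : S -> prod_space) : Prop :=
  forall (J : {set 'I_n}) (B : forall i, set (Z i)),
    (forall i, i \in J -> measurable (B i)) ->
    P [set w | forall i, i \in J -> B i (X w i)] =
      (\prod_(i in J) P [set w | B i (X w i)])%E.

End products.

Section sample_size.
Context {R : realType} {n : nat} {Z : 'I_n -> Type} {Theta : Type}.
Variable F : (forall i, Z i) -> Theta -> R.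

(* [dfwith z i x] is z with its i-th coordinate replaced by x : Z i *)
Definition bounded_difference (i : 'I_n) : \bar R :=
  ereal_sup [set r | exists (theta : Theta) (x : Z i) (z : forall j, Z j),
    r = `|F (dfwith z i x) theta - F z theta|%:E].

(* the inverse of extended reals satisfies 0^-1 = +oo *)
Definition effective_sample_size : \bar R :=
  ((\sum_(i < n) bounded_difference i ^+ 2)^-1)%E.

End sample_size.

Definition rate {R : realType} (x : R) : R :=
  Num.sqrt (ln x / ln 4) +
  2 * Num.min 1 (ln (expR 1 + ln x) / Num.sqrt (ln x)).

(* Main.v *)
Require Import Defs.
From mathcomp Require Import all_boot all_order all_algebra.
From mathcomp Require Import all_classical all_reals all_analysis.
From mathcomp Require Import measurable_realfun ring lra.

(* Subtracting nu from every mu_z does not change the deviations and makes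
   t |-> mu_z (E t) - nu (E t) monotone along the chain with values in [0, M],
   M = 1 + |nu|.  Cut [0, M] into K cells and sort the indices by the cell of
   their mean: in each cell the upward deviations are controlled up to M / K by
   the largest index and the downward ones by the smallest, so that McDiarmid's
   inequality at 2 K indices bounds the supremum.  The prefactor K is absorbed
   by the rate, because only 2 eps^2 >= ln 2 needs a proof and K can be taken of
   order sqrt eta up to logarithms. *)

Set Implicit Arguments.
Unset Strict Implicit.
Unset Printing Implicit Defensive.

Import Order.TTheory GRing.Theory Num.Theory.
Import numFieldNormedType.Exports.

Local Open Scope classical_set_scope.
Local Open Scope ring_scope.

(** * Hoeffding's lemma *)

Section hoeffding_exponential.
Context {R : realType}.

(** Three obstacles shape the argument. An infinite cell need not have a largest or a smallest
    index, so the cells are used on finite sets of indices only, with a bound 2 K p that does not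
    depend on their number, and continuity from below passes to a sequence. The index set carries no
    topology and may be uncountable, so that sequence has to be built: the finitely additive measure
    of the regular chain and the mean together give a real coordinate [Phi] on the chain, and
    indices close in [Phi], on the side dictated by the sign of the deviation, lose almost nothing
    of its absolute value. Finally K must disappear from the bound: the level tau with tau sqrt eta
    = sqrt (eps^2 + ln K / 2) turns 2 K exp (- 2 tau^2 eta) into 2 exp (- 2 eps^2). It remains to
    compare sqrt (eps^2 + ln K / 2) + y / K, y = M sqrt eta, with eps times the rate. At 2 eps^2 =
    ln 2 the square root is eps sqrt (1 + ln K / ln 2), which for K of order y comes near eps sqrt
    (log_4 (y^2)); hence the base 4. *)

Lemma is_derive_ge0_le (f f' : R -> R) (x : R) :
  (forall y, is_derive y (1 : R) f (f' y)) -> (forall y, 0 <= y -> 0 <= f' y) ->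
  0 <= x -> f 0 <= f x.
Proof.
move=> df f'_ge0 x0.
apply: (@ger0_derive1_le_cc _ f 0 x) => //; rewrite ?in_itv/= ?lexx ?x0//.
- by move=> y; rewrite in_itv/= => /andP[/ltW y0 _]; rewrite derive1E derive_val f'_ge0.
- by apply: derivable_within_continuous => y _.
Qed.

(* Second derivative test on the difference of logarithms; q is the mean of a
   Bernoulli law tilted by h, and q (1 - q) <= 1/4 its variance. *)
Lemma convex_expR_le (p h : R) : 0 <= p <= 1 -> 0 <= h ->
  1 - p + p * expR h <= expR (p * h + h ^+ 2 / 8).
Proof.
move=> /andP[p0 p1] h0.
pose D x := 1 - p + p * expR x.
have D0 x : 0 < D x.
  rewrite /D; have := expR_gt0 x; have [->|pn1] := eqVneq p 1; first by lra.
  have : 0 < 1 - p by rewrite subr_gt0 lt_neqAle pn1.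
  by move=> ? ?; rewrite ltr_pwDl// mulr_ge0// ltW.
have dD (x : R) : is_derive x (1 : R) D (p * expR x).
  rewrite -[p * _]add0r.
  exact: is_deriveD (is_derive_cst (1 - p) x 1) (is_deriveZ p (is_derive_expR x)).
pose q x := p * expR x / D x.
have dq (x : R) : is_derive x (1 : R) q (q x * (1 - q x)).
  have Dx0 : D x != 0 by rewrite gt_eqF.
  have dM := is_deriveM (is_deriveZ p (is_derive_expR x)) (is_deriveV Dx0 (dD x)).
  apply: (is_derive_eq dM).
  rewrite -[LHS]/(p * expR x * (- D x ^- 2 * (p * expR x)) +
    (D x)^-1 * (p * expR x)) /q.
  by move: (D x) (expR x) Dx0 => a b a0; field.
pose phi' x := p + x / 4 - q x.
have dphi' (x : R) : is_derive x (1 : R) phi' (4^-1 - q x * (1 - q x)).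
  have dB := is_deriveB (is_deriveD (is_derive_cst p x (1 : R))
    (is_deriveZ 4^-1 (is_derive_id x (1 : R)))) (dq x).
  rewrite (_ : phi' = cst p + 4^-1 *: id - q); last first.
    by apply/funext => y; rewrite /phi' [y / 4]mulrC.
  by apply: (is_derive_eq dB); rewrite add0r -[_ *: _]/(4^-1 * 1) mulr1.
have phi'0 : phi' 0 = 0.
  by rewrite /phi' /q /D expR0 mulr1 subrK divr1 mul0r addr0 subrr.
have phi'_ge0 x : 0 <= x -> 0 <= phi' x.
  move=> x0; rewrite -phi'0; apply: (is_derive_ge0_le dphi') => // y _.
  (* 1/4 - q (1 - q) is the square of q - 1/2. *)
  by have := sqr_ge0 (q y - 2^-1); lra.
pose phi x := p * x + x ^+ 2 / 8 - ln (D x).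
have dphi (x : R) : is_derive x (1 : R) phi (phi' x).
  have dB := is_deriveB (is_deriveD (is_deriveZ p (is_derive_id x (1 : R)))
    (is_deriveZ 8^-1 (is_deriveX 2 (is_derive_id x (1 : R)))))
    (is_derive1_comp (is_derive1_ln (D0 x)) (dD x)).
  rewrite (_ : phi = p *: id + 8^-1 *: (id ^+ 2) - (@ln R \o D)); last first.
    by apply/funext => y; rewrite /phi !fctE /= [_ / 8]mulrC.
  apply: (is_derive_eq dB).
  rewrite -[LHS]/(p * 1 + 8^-1 * (2 * x ^+ 1 * 1) - (D x)^-1 * (p * expR x)).
  rewrite /phi' /q.
  by rewrite [p * expR x / _]mulrC !mulr1 expr1; congr (_ + _ - _); field.
have phi0 : phi 0 = 0.
  by rewrite /phi /D expR0 mulr1 subrK ln1 expr0n/= mulr0 mul0r addr0 subrr.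
have : 0 <= phi h by rewrite -phi0; apply: (is_derive_ge0_le dphi).
by rewrite subr_ge0 -/(D h) -[X in _ -> X <= _](lnK (D0 h)) ler_expR.
Qed.
(** After division by [expR (t * h)], the tangent bound 1 + x <= exp x at x = h - t h and at x = - t
    h, weighted by t and 1 - t, adds up to 1. *)
Lemma chord_expR_ge (t h : R) : 0 <= t <= 1 ->
  expR (t * h) <= 1 - t + t * expR h.
Proof.
move=> /andP[t0 t1].
have e1 : 1 + (h - t * h) <= expR h / expR (t * h) by rewrite -expRB expR_ge1Dx.
have e0 : 1 - t * h <= 1 / expR (t * h).
  by rewrite div1r -expRN (le_trans _ (expR_ge1Dx _)).
rewrite -(ler_pM2r (x := (expR (t * h))^-1)) ?invr_gt0 ?expR_gt0//.
rewrite divff ?gt_eqF ?expR_gt0//.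
rewrite mulrDl -mulrA -[1 - t](mulr1) -mulrA.
have : t * (1 + (h - t * h)) <= t * (expR h / expR (t * h)) by rewrite ler_wpM2l.
have : (1 - t) * (1 - t * h) <= (1 - t) * (1 / expR (t * h)).
  by rewrite ler_wpM2l// subr_ge0.
by rewrite [t * (1 + _)]mulrDr [(1 - t) * (1 - _)]mulrBr; lra.
Qed.
End hoeffding_exponential.

Section bounded_random_variables.
Context {R : realType} {d} {T : measurableType d} (P : probability T R).
Implicit Types f g : T -> R.

Lemma bounded_integrable f : measurable_fun setT f ->
  (exists M : R, forall x, `|f x| <= M) -> P.-integrable setT (EFin \o f).
Proof.
move=> mf [M fM]; apply: measurable_bounded_integrable => //.
  by rewrite -ge0_fin_numE// fin_num_measure.
exists M; split; first exact: num_real.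
by move=> x Mx y _; apply: (le_trans (fM _)); exact: ltW.
Qed.

Lemma prob_Rintegral_cst (r : R) : \int[P]_x r = r.
Proof.
rewrite Rintegral_cst// -[RHS]mulr1; congr (_ * _).
rewrite -[RHS]/(fine 1%:E); congr (fine _).
exact: probability_setT.
Qed.

Lemma le_prob_Rintegral f g :
  measurable_fun setT f -> (exists M : R, forall x, `|f x| <= M) ->
  measurable_fun setT g -> (exists M : R, forall x, `|g x| <= M) ->
  (forall x, f x <= g x) -> \int[P]_x f x <= \int[P]_x g x.
Proof.
move=> mf bf mg bg fg.
by apply: le_Rintegral => //; exact: bounded_integrable.
Qed.

Lemma itv_bounded f (a b : R) : (forall x, a <= f x <= b) ->
  exists M : R, forall x, `|f x| <= M.
Proof.
move=> fab; exists (Num.max (- a) b) => x; have /andP[af fb] := fab x.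
by rewrite ler_norml lerNl !le_max lerN2 af fb orbT.
Qed.

(** With a the infimum of f, the chord of x |-> exp (s x) over [a, a + c] is affine in f, so its
    integral is its value at the mean, which [convex_expR_le] bounds. The hypothesis is on the
    oscillation of f because that is what bounded differences control. *)
Lemma hoeffding_lemma f (c s : R) : measurable_fun setT f ->
  (forall x y, f x - f y <= c) -> 0 <= s ->
  \int[P]_x expR (s * f x) <= expR (s * (\int[P]_x f x) + (s * c) ^+ 2 / 8).
Proof.
move=> mf fc s0.
pose a := inf (range f).
have lbf y : lbound (range f) (f y - c).
  by move=> _ [x _ <-]; rewrite lerBlDl addrC -lerBlDl.
have af x : a <= f x.
  by apply: ge_inf; [exists (f point - c)|exists x].
have fac x : f x <= a + c.
  rewrite -lerBlDr; apply: lb_le_inf => //.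
  by exists (f point); exists point.
have bf : exists M : R, forall x, `|f x| <= M.
  by apply: (@itv_bounded _ a (a + c)) => x; rewrite af fac.
have intf := bounded_integrable mf bf.
pose m := \int[P]_x f x.
have am : a <= m.
  rewrite -(prob_Rintegral_cst a); apply: le_prob_Rintegral => //.
  by exists `|a|.
have mac : m <= a + c.
  rewrite -(prob_Rintegral_cst (a + c)); apply: le_prob_Rintegral => //.
  by exists `|a + c|.
have c0 : 0 <= c by have := fc point point; rewrite subrr.
(* The rescaling [p] below divides by c; for c = 0 the function is constant. *)
have [c00|cn0] := eqVneq c 0.
  have fa x : f x = a by apply/le_anti; rewrite af (le_trans (fac x)) ?c00 ?addr0.
  under eq_Rintegral do rewrite fa.
  rewrite prob_Rintegral_cst -/m (_ : m = a); last first.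
    by apply/le_anti; rewrite am (le_trans mac) ?c00 ?addr0.
  by rewrite c00 mulr0 expr0n/= mul0r addr0.
have c1 : 0 < c by rewrite lt_neqAle eq_sym cn0.
pose p x := (x - a) / c.
have p01 x : a <= x <= a + c -> 0 <= p x <= 1.
  move=> /andP[ax xac]; rewrite /p divr_ge0 ?subr_ge0//=.
  by rewrite ler_pdivrMr// mul1r lerBlDl.
have pE x : s * x = s * a + p x * (s * c) by rewrite /p; field.
apply: (@le_trans _ _ (\int[P]_x
    (expR (s * a) * (1 - p (f x) + p (f x) * expR (s * c))))).
  apply: le_prob_Rintegral.
  - by apply: measurableT_comp => //; exact: measurable_funM.
  - exists (expR (s * (a + c))) => x.
    by rewrite ger0_norm ?expR_ge0// ler_expR ler_wpM2l.
  - apply: measurable_funM => //; apply: measurable_funD.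
      apply: measurable_funB => //; apply: measurable_funM => //.
      exact: measurable_funB.
    apply: measurable_funM => //; apply: measurable_funM => //.
    exact: measurable_funB.
  - exists (expR (s * a) * (1 + expR (s * c))) => x.
    have /andP[p0 p1] : 0 <= p (f x) <= 1 by rewrite p01// af fac.
    rewrite ger0_norm.
      rewrite ler_wpM2l ?expR_ge0// lerD//; first by rewrite gerBl.
      by rewrite ler_piMl// expR_ge0.
    by rewrite mulr_ge0 ?expR_ge0// addr_ge0 ?subr_ge0// mulr_ge0// expR_ge0.
  - move=> x; rewrite (pE (f x)) expRD ler_wpM2l ?expR_ge0//.
    by apply: chord_expR_ge; rewrite p01// af fac.
have intE : \int[P]_x (expR (s * a) * (1 - p (f x) + p (f x) * expR (s * c))) =
    expR (s * a) * (1 - p m + p m * expR (s * c)).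
  pose k := expR (s * a) * (expR (s * c) - 1) / c.
  pose l := expR (s * a) - k * a.
  transitivity (\int[P]_x (l + k * f x)).
    by apply: eq_Rintegral => x _; rewrite /l /k /p; field.
  rewrite RintegralD//=; last 2 first.
  - by apply: bounded_integrable => //; exists `|l|.
  - exact: (integrableZl measurableT k intf).
  rewrite prob_Rintegral_cst RintegralZl// -/m /l /k /p; field; exact: cn0.
rewrite intE -/m (pE m) -[X in _ <= expR X]addrA [leRHS]expRD ler_wpM2l ?expR_ge0//.
by apply: convex_expR_le; rewrite ?p01 ?am ?mac ?mulr_ge0.
Qed.
End bounded_random_variables.

(** * McDiarmid's inequality on a finite product *)

Section resampling.
Context {R : realType} {n : nat} {dZ : 'I_n -> measure_display}.
Context {Z : forall i, measurableType (dZ i)}.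
Notation pZ := (prod_space Z).
Implicit Types (z y : pZ) (i j : 'I_n).

(** Taking a full vector y, of which only the i-th coordinate is read, makes resampling a map on
    [pZ * pZ]: the same product measure serves for every i, without marginals on the factors. *)
Definition resample i z y : pZ := dfwith z i (y i).

Definition box (B : forall i, set (Z i)) : set pZ := [set z | forall i, B i (z i)].

Lemma measurable_proj i : measurable_fun [set: pZ] (fun z => z i).
Proof.
move=> _ B mB; apply: sub_sigma_algebra; exists i => //.
by exists B => //.
Qed.

Lemma measurable_prod_space d (T : measurableType d) (f : T -> pZ) :
  (forall i, measurable_fun setT (fun x => f x i)) -> measurable_fun setT f.
Proof.
move=> mf.
refine (@measurability _ _ T (prod_space Z) setT f (@cylinders _ _ Z) _ _) => //.
by move=> _ [_ [i _ [B mB <-]] <-]; rewrite setTI; apply: mf.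
Qed.

Lemma measurable_resample i :
  measurable_fun setT (fun zy : pZ * pZ => resample i zy.1 zy.2).
Proof.
apply: measurable_prod_space => j; rewrite /resample.
have [<-|ij] := eqVneq i j.
  rewrite (_ : (fun zy => _) = (fun zy : pZ * pZ => zy.2 i)); last first.
    by apply/funext => zy; rewrite dfwithin.
  exact: measurableT_comp (@measurable_proj i) measurable_snd.
rewrite (_ : (fun zy => _) = (fun zy : pZ * pZ => zy.1 j)); last first.
  by apply/funext => zy; rewrite dfwithout.
exact: measurableT_comp (@measurable_proj j) measurable_fst.
Qed.

Lemma measurable_box B : (forall i, measurable (B i)) -> measurable (box B).
Proof.
move=> mB.
rewrite (_ : box B =
    \bigcap_(i in [set: 'I_n]) (fun z : pZ => z i) @^-1` B i).
  apply: fin_bigcap_measurable => // i _.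
  by rewrite -[X in measurable X]setTI; apply: measurable_proj.
by apply/seteqP; split=> [z zB i _|z zB i]; [exact: zB|exact: (zB i I)].
Qed.

(** Boxes form a pi-system containing the whole space, and they generate the sigma-algebra because a
    cylinder is a box whose other sides are full. *)
Lemma eq_measure_box (m1 m2 : {measure set pZ -> \bar R}) :
  (m1 setT < +oo)%E ->
  (forall B, (forall i, measurable (B i)) -> m1 (box B) = m2 (box B)) ->
  forall A, measurable A -> m1 A = m2 A.
Proof.
move=> m1oo m12 A mA.
have boxT : box (fun i => setT) = setT by apply/seteqP; split.
pose G := [set A : set pZ | exists2 B, (forall i, measurable (B i)) & A = box B].
apply: (g_sigma_algebra_measure_unique_trace G setT) => //.
- by move=> _ [[B mB ->] _]; exact: measurable_box.
- move=> _ _ [[B mB ->] _] [[B' mB' ->] _]; split => //.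
  exists (fun i => B i `&` B' i); first by move=> i; exact: measurableI.
  apply/seteqP; split=> [z [zB zB'] i|z zB].
    by split; [exact: zB|exact: zB'].
  by split=> i; have [] := zB i.
- by rewrite -boxT; exact: m12.
- by move=> _ [[B mB ->] _]; exact: m12.
- move: A mA; apply: sub_smallest2r => //.
  move=> _ [i _ [B mB <-]]; split => //.
  exists (dfwith (fun j => [set: Z j]) i B).
    by move=> j; case: dfwithP.
  rewrite setTI; apply/seteqP; split=> [z zB j|z /(_ i)]; last by rewrite dfwithin.
  by case: dfwithP.
Qed.

Variable Q : probability pZ R.
Hypothesis Qind : forall B, (forall i, measurable (B i)) ->
  Q (box B) = (\prod_(i < n) Q [set z | B i (z i)])%E.

(** Independence enters McDiarmid's inequality only here. The preimage of a box is the box with its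
    i-th side made full, times the condition on the i-th coordinate of the copy; the product formula
    for Q shows that nothing has changed, and boxes determine the measure. *)
Lemma resample_measure i A : measurable A ->
  (Q \x Q)%E ((fun zy => resample i zy.1 zy.2) @^-1` A) = Q A.
Proof.
move=> mA.
pose phi : {mfun (pZ * pZ)%type >-> pZ} := mfun_Sub (mem_set (measurable_resample i)).
rewrite -[LHS]/(pushforward (Q \x Q)%E phi A).
apply: (eq_measure_box _ _ mA) => /=.
  exact: le_lt_trans (probability_le1 (Q \x Q)%E measurableT) (ltry _).
move=> B mB; rewrite /pushforward.
pose B' := dfwith B i setT.
have mB' j : measurable (B' j) by rewrite /B'; case: dfwithP.
have mBi : measurable [set z : pZ | B i (z i)].
  by rewrite -[X in measurable X]setTI; apply: measurable_proj.
rewrite (_ : _ @^-1` _ = box B' `*` [set z : pZ | B i (z i)]); last first.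
  apply/seteqP; split=> [[z y]/= zyB|[z y]/= [zB' yB] j].
    split; last by have := zyB i; rewrite /resample dfwithin.
    move=> j; rewrite /B'; have := zyB j; rewrite /resample.
    by case: dfwithP => [|j' ij']; rewrite ?dfwithin// !dfwithout.
  have := zB' j; rewrite /resample /B'.
  by have [<-|ij] := eqVneq i j; rewrite ?dfwithin// !dfwithout.
rewrite product_measure1E//; last exact: measurable_box.
rewrite [X in (X * _)%E](Qind mB') [RHS](Qind mB).
rewrite [in RHS](bigD1 i)//= [in LHS](bigD1 i)//= {1}/B' dfwithin.
rewrite (_ : [set z | _] = setT); last by apply/seteqP; split.
rewrite probability_setT mul1e muleC; congr (_ * _)%E.
by apply: eq_bigr => j ji; rewrite /B' dfwithout// eq_sym.
Qed.

(* Integrates out the i-th coordinate, resampled from an independent copy. *)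
Definition avg i (f : pZ -> R) z := \int[Q]_y f (resample i z y).

Section average.
Variables (i : 'I_n) (f : pZ -> R) (M : R).
Hypotheses (mf : measurable_fun setT f) (fM : forall z, `|f z| <= M).

Let mfr : measurable_fun setT (fun zy : pZ * pZ => f (resample i zy.1 zy.2)).
Proof. exact: measurableT_comp mf (@measurable_resample i). Qed.

Let mfr2 z : measurable_fun setT (fun y : pZ => f (resample i z y)).
Proof. exact: measurableT_comp mfr (@measurable_pair1 _ _ pZ pZ z). Qed.

Let avgE z : (\int[Q]_y (f (resample i z y))%:E = (avg i f z)%:E)%E.
Proof.
rewrite /avg /Rintegral fineK//; apply: integrable_fin_num => //.
by apply: bounded_integrable => //; exists M.
Qed.

Let ifr : (Q \x Q)%E.-integrable setT
  (EFin \o (fun zy : pZ * pZ => f (resample i zy.1 zy.2))).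
Proof. by apply: bounded_integrable => //; exists M. Qed.

Lemma measurable_avg : measurable_fun setT (avg i f).
Proof.
apply/measurable_EFinP.
rewrite (_ : EFin \o _ = fubini_F Q
    (EFin \o (fun zy : pZ * pZ => f (resample i zy.1 zy.2)))).
  exact: (measurable_fubini_F ifr).
by apply/funext => z; rewrite /fubini_F/= avgE.
Qed.

Lemma avg_bounded z : `|avg i f z| <= M.
Proof.
rewrite ler_norml; apply/andP; split.
  rewrite -(prob_Rintegral_cst Q (- M)); apply: le_prob_Rintegral => //.
  - by exists `|- M|.
  - by exists M.
  - by move=> y; have := fM (resample i z y); rewrite ler_norml => /andP[].
rewrite -(prob_Rintegral_cst Q M); apply: le_prob_Rintegral => //.
- by exists M.
- by exists `|M|.
- by move=> y; have := fM (resample i z y); rewrite ler_norml => /andP[].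
Qed.

(** By Fubini the left side is the integral of f against the law of [resample i] under two
    independent copies, which is Q by [resample_measure]. *)
Lemma Rintegral_avg : \int[Q]_z avg i f z = \int[Q]_z f z.
Proof.
rewrite /Rintegral; congr fine.
transitivity (\int[Q]_z fubini_F Q
    (EFin \o (fun zy : pZ * pZ => f (resample i zy.1 zy.2))) z)%E.
  by apply: eq_integral => z _; rewrite /fubini_F/= avgE.
rewrite integral12_prod_meas1//.
pose phi : {mfun (pZ * pZ)%type >-> pZ} := mfun_Sub (mem_set (measurable_resample i)).
transitivity (\int[pushforward (Q \x Q)%E phi]_y (f y)%:E)%E.
  by rewrite integral_pushforward//; exact/measurable_EFinP.
by apply: eq_measure_integral => A mA _; exact: resample_measure.
Qed.

Lemma avg_diff z z' c :
  (forall y, f (resample i z y) - f (resample i z' y) <= c) ->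
  avg i f z - avg i f z' <= c.
Proof.
move=> fc; rewrite lerBlDr -(prob_Rintegral_cst Q c) -RintegralD//=; last 2 first.
- by apply: bounded_integrable => //; exists `|c|.
- by apply: bounded_integrable => //; exists M.
apply: le_prob_Rintegral => //.
- by exists M.
- exact: measurable_funD.
- by exists (`|c| + M) => y; rewrite (le_trans (ler_normD _ _))// lerD2l.
- by move=> y; rewrite -lerBlDr.
Qed.

End average.

Lemma resample_resample i z y y' : resample i (resample i z y) y' = resample i z y'.
Proof.
apply: functional_extensionality_dep => j; rewrite /resample.
by case: dfwithP => [|k ik]; rewrite ?dfwithin// !dfwithout.
Qed.

Lemma resampleC i j z y y' : i != j ->
  resample i (resample j z y) y' = resample j (resample i z y') y.
Proof.
move=> ij; apply: functional_extensionality_dep => k; rewrite /resample.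
have [<-|ik] := eqVneq i k.
  by rewrite dfwithin dfwithout 1?eq_sym// dfwithin.
rewrite dfwithout//; have [<-|jk] := eqVneq j k; first by rewrite !dfwithin.
by rewrite !dfwithout.
Qed.

Definition has_bounded_differences (f : pZ -> R) (c : 'I_n -> R) :=
  forall i z y, `|f (resample i z y) - f z| <= c i.

(** The hybrids [mix k], equal to y on the first k coordinates and to z on the others, lead from z
    to y by changing one coordinate at a time. *)
Lemma bounded_differences_oscillation f c : has_bounded_differences f c ->
  forall z y, `|f y - f z| <= \sum_i c i.
Proof.
move=> fc z y.
have c0 i : 0 <= c i by exact: le_trans (normr_ge0 _) (fc i z y).
pose mix k : pZ := fun i => if (i < k)%N then y i else z i.
have mixS k (kn : (k < n)%N) : mix k.+1 = resample (Ordinal kn) (mix k) y.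
  apply: functional_extensionality_dep => i; rewrite /resample /mix.
  have [<-|ki] := eqVneq (Ordinal kn) i; first by rewrite dfwithin ltnSn.
  rewrite dfwithout// ltnS leq_eqVlt; congr (if _ then _ else _).
  suff -> : (i == k :> nat) = false by [].
  by apply: contra_neqF ki => /eqP ik; exact: val_inj.
have mix_le k : (k <= n)%N -> `|f (mix k) - f z| <= \sum_(i < n | (i < k)%N) c i.
  elim: k => [_|k ih kn].
    by rewrite (_ : mix 0 = z)// subrr normr0 sumr_ge0.
  rewrite mixS (bigD1 (Ordinal kn))//=.
  rewrite (le_trans (ler_distD (f (mix k)) _ _))// lerD//.
  rewrite (le_trans (ih (ltnW kn)))// le_eqVlt; apply/orP; left; apply/eqP.
  by apply: eq_bigl => i; rewrite ltnS -val_eqE/=; case: ltngtP.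
have := mix_le n (leqnn n).
rewrite (_ : mix n = y); last first.
  by apply: functional_extensionality_dep => i; rewrite /mix ltn_ord.
by under eq_bigl do rewrite ltn_ord.
Qed.

Lemma bounded_differences_bounded f c : has_bounded_differences f c ->
  exists M : R, forall z, `|f z| <= M.
Proof.
move=> /bounded_differences_oscillation fc.
exists (\sum_i c i + `|f point|) => z.
by rewrite -{1}(subrK (f point) (f z)) (le_trans (ler_normD _ _))// lerD2r.
Qed.

(** A second resampling of coordinate i overrides the first, so the i-th constant drops to 0;
    resampling another coordinate commutes with averaging over i and keeps its constant. *)
Lemma avg_bounded_differences i f c : measurable_fun setT f ->
  has_bounded_differences f c ->
  has_bounded_differences (avg i f) (fun j => if j == i then 0 else c j).
Proof.
move=> mf fc j z y; have [M fM] := bounded_differences_bounded fc.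
have [->|ji] := eqVneq j i.
  have -> : avg i f (resample i z y) = avg i f z.
    by rewrite /avg; apply: eq_Rintegral => x _; rewrite resample_resample.
  by rewrite subrr normr0.
have fcx x : `|f (resample i (resample j z y) x) - f (resample i z x)| <= c j.
  by rewrite resampleC 1?eq_sym.
rewrite ler_norml lerNl opprB; apply/andP; split; apply: (avg_diff mf fM) => x.
  by rewrite (le_trans (ler_norm _))// distrC.
by rewrite (le_trans (ler_norm _)).
Qed.

Lemma expR_bounded_difference_le (s : R) f c : 0 <= s -> measurable_fun setT f ->
  has_bounded_differences f c ->
  \int[Q]_z expR (s * f z) <=
    expR (s * \int[Q]_z f z + s ^+ 2 * (\sum_i c i ^+ 2) / 8).
Proof.
move=> s0.
have mes g : measurable_fun setT g ->
    measurable_fun setT (fun z : pZ => expR (s * g z)).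
  by move=> mg; apply: measurableT_comp => //; exact: measurable_funM.
have bes g : (exists M : R, forall z, `|g z| <= M) ->
    exists M : R, forall z : pZ, `|expR (s * g z)| <= M.
  move=> [M gM]; exists (expR (s * M)) => z.
  by rewrite ger0_norm ?expR_ge0// ler_expR ler_wpM2l// (le_trans (ler_norm _)).
(* induction on a list of the coordinates on which f still depends: averaging
   over i costs one application of Hoeffding's lemma and kills c i *)
suff H (r : seq 'I_n) : forall f c, (forall i, i \notin r -> c i = 0) ->
    measurable_fun setT f -> has_bounded_differences f c ->
    \int[Q]_z expR (s * f z) <=
    expR (s * \int[Q]_z f z + s ^+ 2 * (\sum_i c i ^+ 2) / 8).
  by apply: (H (enum 'I_n)) => i; rewrite mem_enum.
elim: r => [|i r ih] {}f {}c cr mf fc.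
  have c0 i : c i = 0 by exact: cr.
  have fp z : f z = f point.
    have := bounded_differences_oscillation fc point z.
    by rewrite big1// normr_le0 subr_eq0 => /eqP.
  under eq_Rintegral do rewrite fp.
  rewrite prob_Rintegral_cst; under [in leRHS]eq_Rintegral do rewrite fp.
  rewrite prob_Rintegral_cst ler_expR lerDl divr_ge0// mulr_ge0 ?sqr_ge0//.
  apply: sumr_ge0 => j _.
  exact: sqr_ge0.
have [M fM] := bounded_differences_bounded fc.
pose c' j := if j == i then 0 else c j.
have mef := mes _ mf.
have bef := bes _ (ex_intro _ M fM).
have maf := measurable_avg i mf fM.
have baf := avg_bounded i mf fM.
have [M' efM'] := bef.
rewrite -(Rintegral_avg i mef efM').
apply: (@le_trans _ _ (\int[Q]_z (expR ((s * c i) ^+ 2 / 8) * expR (s * avg i f z)))).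
  have [M2 eafM2] := bes _ (ex_intro _ M baf).
  apply: le_prob_Rintegral.
  - exact: measurable_avg efM'.
  - by exists M'; exact: avg_bounded.
  - by apply: measurable_funM => //; exact: mes.
  - exists (expR ((s * c i) ^+ 2 / 8) * M2) => z.
    by rewrite normrM [X in X * _]ger0_norm ?expR_ge0// ler_wpM2l ?expR_ge0.
  - move=> z; rewrite -expRD addrC; apply: hoeffding_lemma => //.
      exact: measurableT_comp (measurableT_comp mf (@measurable_resample i))
        (@measurable_pair1 _ _ pZ pZ z).
    (* With z fixed, the vectors resampled from y and from y' differ in coordinate i only, so the
       oscillation is at most [c i]. *)
    move=> y y'; rewrite (le_trans (ler_norm _))//.
    by rewrite -(resample_resample i z y' y).
rewrite RintegralZl//; last first.
  by apply: bounded_integrable; [exact: mes|apply: bes; exists M].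
rewrite -(Rintegral_avg i mf fM).
have ih' := ih (avg i f) c' _ maf (avg_bounded_differences i mf fc).
have /ih' {}ih' : forall j, j \notin r -> c' j = 0.
  move=> j jr; rewrite /c'; case: ifPn => // ji.
  by apply: cr; rewrite inE negb_or ji.
apply: le_trans (ler_wpM2l (expR_ge0 _) ih') _.
rewrite -expRD ler_expR le_eqVlt; apply/orP; left; apply/eqP.
rewrite [in RHS](bigD1 i)//= [in LHS](bigD1 i)//= {1}/c' eqxx expr0n/= add0r.
rewrite (eq_bigr (fun j => c j ^+ 2)); last by move=> j ji; rewrite /c' (negPf ji).
by rewrite exprMn; field.
Qed.

Lemma mcdiarmid_inequality f c (t : R) : measurable_fun setT f ->
  has_bounded_differences f c -> 0 < \sum_i c i ^+ 2 -> 0 <= t ->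
  (Q [set z | (t <= f z - \int[Q]_y f y)%R] <=
   (expR (- 2 * t ^+ 2 / \sum_i c i ^+ 2)%R)%:E)%E.
Proof.
move=> mf fc; set V := \sum_i _ => V0; rewrite le_eqVlt => /predU1P[<-|t0].
  rewrite expr0n/= mulr0 mul0r expR0; apply: probability_le1.
  rewrite -[X in measurable X]setTI; apply: measurable_fun_le => //.
  exact: measurable_funB.
(* The minimiser of the exponent s^2 V / 8 - s t, with minimum - 2 t^2 / V. It vanishes for t = 0, a
   case treated apart because [chernoff] takes a positive parameter. *)
pose s := 4 * t / V.
have s0 : 0 < s by rewrite divr_gt0// mulr_gt0.
pose X : {RV Q >-> R} := mfun_Sub (mem_set mf).
set m := \int[Q]_y f y.
rewrite (_ : [set z | _] = [set z | X z >= m + t]%R); last first.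
  by apply/seteqP; split=> z /=; rewrite lerBrDl.
apply: (le_trans (chernoff X (m + t) s0)).
have [M fM] := bounded_differences_bounded fc.
have intE : ('M_Q X s = (\int[Q]_z expR (s * f z))%:E)%E.
  rewrite /mmt_gen_fun unlock /Rintegral fineK.
    by apply: eq_integral => z _ /=; rewrite mulrC.
  apply: integrable_fin_num => //; apply: bounded_integrable.
    by apply: measurableT_comp => //; exact: measurable_funM.
  exists (expR (s * M)) => z.
  rewrite ger0_norm ?expR_ge0// ler_expR ler_wpM2l ?(ltW s0)//.
  exact: le_trans (ler_norm _) (fM z).
rewrite intE -EFinM lee_fin.
have := expR_bounded_difference_le (ltW s0) mf fc.
rewrite -(ler_pM2r (expR_gt0 (- (s * (m + t))))) => /le_trans; apply.
rewrite -expRD ler_expR le_eqVlt; apply/orP; left; apply/eqP.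
by rewrite -/m -/V /s; field; rewrite gt_eqF.
Qed.
End resampling.

(** * The rate function *)

Section rate_bounds.
Context {R : realType}.

(** The bound 1 + x <= exp x is nearly sharp at the small arguments 72/1600 and - 67/1600; squaring
    four times, with intermediate values rounded down, reaches the sixteenth power. *)
Lemma ln2_bounds : 67 / 100 <= ln (2 : R) <= 72 / 100.
Proof.
have exp16 (x : R) : expR (16 * x) = (((expR x ^+ 2) ^+ 2) ^+ 2) ^+ 2.
  by rewrite -!exprM -expRM_natl.
have sqr_lb (a c e : R) : 0 <= c -> c <= a -> e <= c ^+ 2 -> e <= a ^+ 2.
  by move=> c0 ca ec; apply: le_trans ec _; rewrite ler_sqr ?nnegrE// (le_trans c0).
apply/andP; split; rewrite -ler_expR lnK ?posrE//.
  have := @expR_ge1Dx R (- (67 / 1600)).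
  have -> : 67 / 100 = 16 * (67 / 1600) :> R by lra.
  rewrite exp16 -[expR _ in X in _ -> X]invrK -expRN; set z := expR _ => z1.
  have z2 : 918 / 1000 <= z ^+ 2 by apply: sqr_lb z1 _; clear; lra.
  have z4 : 8427 / 10000 <= (z ^+ 2) ^+ 2 by apply: sqr_lb z2 _; clear; lra.
  have z8 : 7101 / 10000 <= ((z ^+ 2) ^+ 2) ^+ 2 by apply: sqr_lb z4 _; clear; lra.
  have z16 : 1 / 2 <= (((z ^+ 2) ^+ 2) ^+ 2) ^+ 2 by apply: sqr_lb z8 _; clear; lra.
  rewrite !exprVn -[leRHS]invrK lef_pV2 ?posrE ?invr_gt0 ?exprn_gt0 ?expR_gt0//.
  by rewrite -div1r.
have := @expR_ge1Dx R (72 / 1600).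
have -> : 72 / 100 = 16 * (72 / 1600) :> R by lra.
rewrite exp16; set z := expR _ => z1.
have z2 : 10920 / 10000 <= z ^+ 2 by apply: sqr_lb z1 _; clear; lra.
have z4 : 11924 / 10000 <= (z ^+ 2) ^+ 2 by apply: sqr_lb z2 _; clear; lra.
have z8 : 14218 / 10000 <= ((z ^+ 2) ^+ 2) ^+ 2 by apply: sqr_lb z4 _; clear; lra.
by apply: sqr_lb z8 _; clear; lra.
Qed.

Lemma archimedean_above (x : R) : 0 < x -> exists K : nat, x < K%:R <= x + 1.
Proof.
move=> x0; exists (Num.trunc x).+1.
by have /andP[tx ->] := truncn_itv (ltW x0); rewrite -natr1 lerD2r.
Qed.

(* Here y = M sqrt eta.  In the first case the tail event is empty; in the second
   K is the number of cells: about 3 y when the minimum in [rate] is 1, and about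
   2 y sqrt (ln (y ^ 2)) otherwise. *)
Lemma rate_dichotomy (y eps : R) : 1 < y -> 0 < eps -> ln 2 <= 2 * eps ^+ 2 ->
  y < eps * rate (y ^+ 2) \/
  exists2 K : nat, (0 < K)%N &
    Num.sqrt (eps ^+ 2 + ln K%:R / 2) + y / K%:R < eps * rate (y ^+ 2).
Proof.
move=> y1 eps0 eps2.
have y0 : 0 < y by lra.
have /andP[l1 l2] := ln2_bounds.
have ln4 : ln 4 = 2 * ln 2 :> R.
  by rewrite (_ : 4 = 2 ^+ 2) ?lnXn// ?mulr_natl//; lra.
pose b : R := Num.sqrt (2 * ln 2).
have b0 : 0 <= b by exact: sqrtr_ge0.
have bb : b ^+ 2 = 2 * ln 2 by rewrite sqr_sqrtr//; lra.
have b1 : 115 / 100 <= b by nra.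
have b2 : b <= 12 / 10 by nra.
have bp : 0 < b by lra.
have eb : b / 2 <= eps by nra.
pose w := ln (y ^+ 2).
have wE : w = 2 * ln y by rewrite /w lnXn// mulr_natl.
have w0 : 0 < w by rewrite wE mulr_gt0// ln_gt0.
pose sw := Num.sqrt w.
have sw0 : 0 < sw by rewrite sqrtr_gt0.
have swE : sw ^+ 2 = w by rewrite sqr_sqrtr// ltW.
pose S := sw / b.
have S0 : 0 < S by rewrite divr_gt0.
have SE : S ^+ 2 = w / (2 * ln 2) by rewrite /S expr_div_n bb swE.
have rateE : rate (y ^+ 2) = S + 2 * Num.min 1 (ln (expR 1 + w) / sw).
  rewrite /rate -/w -/sw ln4; congr (_ + _).
  by rewrite -SE sqrtr_sqr ger0_norm// ltW.
(* b / 2 is the least eps with 2 eps^2 >= ln 2, which is the worst case *)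
have reduce (a : R) (K : nat) : (0 < K)%N ->
    Num.sqrt (1 + ln K%:R / ln 2) + 2 / b * (y / K%:R) < a ->
    Num.sqrt (eps ^+ 2 + ln K%:R / 2) + y / K%:R < eps * a.
  move=> K0 Ka; have K1 : 1 <= K%:R :> R by rewrite ler1n.
  have lnK0 : 0 <= ln K%:R :> R by exact: ln_ge0.
  move: Ka; rewrite -(ltr_pM2l eps0); apply: le_lt_trans.
  rewrite mulrDr lerD//.
    rewrite -[X in _ <= X * _](ger0_norm (ltW eps0)) -sqrtr_sqr -sqrtrM ?sqr_ge0//.
    apply: ler_wsqrtr; rewrite mulrDr mulr1 lerD2l.
    rewrite mulrA ler_pdivlMr; last by lra.
    rewrite mulrAC [eps ^+ 2 * _]mulrC -mulrA ler_wpM2l//; lra.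
  have yK : 0 <= y / K%:R by rewrite divr_ge0// ltW.
  rewrite mulrA ler_peMl// mulrA ler_pdivlMr//; lra.
have [m1|m1] := leP 1 (ln (expR 1 + w) / sw).
  rewrite rateE (min_l m1) mulr1.
  (* For y below 115/100 the summand 2 of the rate is enough, since 2 eps >= b >= 115/100. Otherwise
     ln y stays away from 0, and so does S. *)
  have [y115|y115] := ltP y (115 / 100).
    left; apply: (@lt_le_trans _ _ (b / 2 * (S + 2))); first by nra.
    by rewrite ler_wpM2r//; lra.
  right; have [K /andP[K3 K3']] := archimedean_above (mulr_gt0 (ltr0Sn R 2) y0).
  have K0 : (0 < K)%N by rewrite -(ltr0n R); lra.
  exists K => //; apply: (reduce _ _ K0).
  have lny : 13 / 100 <= ln y.
    have : ln y^-1 <= y^-1 - 1.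
      by rewrite -[X in ln X](subrK 1) addrC le_ln1Dx// ltrBrDr addNr invr_gt0.
    rewrite lnV// => h; suff : y^-1 <= 87 / 100 by lra.
    by rewrite -[leRHS]invrK lef_pV2 ?posrE//; lra.
  have S1 : 36 / 100 <= S.
    suff : 18 / 100 <= S ^+ 2 by nra.
    by rewrite SE wE ler_pdivlMr; lra.
  (* Here K <= 3 y + 1 <= 4 y. The available 2 is then split: sqrt (S^2 + 3) exceeds S by less than
     142/100, as S >= 36/100, and the term y / K takes at most 58/100. *)
  have lnK : 1 + ln K%:R / ln 2 <= S ^+ 2 + 3.
    have : ln K%:R <= 2 * ln 2 + w / 2.
      rewrite wE [2 * ln y]mulrC mulfK// -ln4 -lnM ?posrE//.
      by rewrite ler_ln ?posrE ?mulr_gt0 ?ltr0n//; lra.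
    move=> h; suff : ln K%:R / ln 2 <= S ^+ 2 + 2 by lra.
    rewrite SE ler_pdivrMr; last by lra.
    rewrite mulrDl (_ : w / (2 * ln 2) * ln 2 = w / 2); first by lra.
    by field; lra.
  have sK : Num.sqrt (1 + ln K%:R / ln 2) < S + 142 / 100.
    apply: (@le_lt_trans _ _ (Num.sqrt (S ^+ 2 + 3))); first exact: ler_wsqrtr.
    have S2 : 0 < S + 142 / 100 by clear - S0; lra.
    rewrite -(ger0_norm (ltW S2)) -sqrtr_sqr ltr_sqrt ?exprn_gt0//.
    by clear - S1; nra.
  have yK : 2 / b * (y / K%:R) <= 58 / 100.
    rewrite mulf_div ler_pdivrMr ?mulr_gt0 ?ltr0n//; nra.
  lra.
right; rewrite rateE (min_r (ltW m1)).
set v := ln (expR 1 + w).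
have v1 : 1 <= v.
  by rewrite -[leLHS]expRK ler_ln ?posrE ?addr_gt0 ?expR_gt0//; lra.
have vsw : v <= sw by rewrite -[leRHS]mul1r -ler_pdivrMr// ltW.
have w1 : 1 <= w by rewrite -swE; nra.
have lnw0 : 0 <= ln w by exact: ln_ge0.
have y15 : 3 / 2 <= y.
  rewrite -(lnK (y0 : y \is Num.pos)); apply: le_trans (expR_ge1Dx _); lra.
have [K /andP[K2 K2']] := archimedean_above (mulr_gt0 (mulr_gt0 (ltr0Sn R 1) y0) sw0).
have K0 : (0 < K)%N by rewrite -(ltr0n R) (lt_trans _ K2)// !mulr_gt0.
exists K => //; apply: (reduce _ _ K0).
have ysw : 3 / 2 <= y * sw by nra.
(* AM-GM: e + w >= 2 sqrt (e w) *)
have v_ge : 67 / 100 + 1 / 2 + ln w / 2 <= v.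
  have : expR (ln 2 + 1 / 2 + ln w / 2) <= expR 1 + w.
    have -> : expR 1 + w = expR (1 / 2) ^+ 2 + expR (ln w / 2) ^+ 2.
      rewrite -!expRM_natl (_ : 2%:R * (1 / 2) = 1 :> R); last by field.
      rewrite (_ : 2%:R * (ln w / 2) = ln w :> R); last by field.
      by rewrite lnK// posrE.
    rewrite !expRD lnK ?posrE//.
    have := sqr_ge0 (expR (1 / 2) - expR (ln w / 2) : R); nra.
  move=> h; have : ln 2 + 1 / 2 + ln w / 2 <= v.
    by rewrite -ler_expR lnK// posrE addr_gt0// expR_gt0.
  lra.
(* With u = y * sw >= 3/2, K <= 2 u + 1 gives K^2 <= 8 u^2; the 5/2 is 1 plus ln 8 / (2 ln 2). *)
have lnK : 1 + ln K%:R / ln 2 <= S ^+ 2 + (5 / 2 + ln w / (2 * ln 2)).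
  have : 2 * ln K%:R <= 3 * ln 2 + w + ln w.
    have KK : K%:R ^+ 2 <= 2 ^+ 3 * (y ^+ 2 * w).
      rewrite -swE -exprMn; have K1 : 0 <= K%:R :> R by [].
      move: K2' K1; rewrite -mulrA; clear - ysw.
      move: (K%:R) (y * sw) ysw => k u u2 ku k0.
      apply: (@le_trans _ _ ((2 * u + 1) ^+ 2)); last by nra.
      by rewrite ler_sqr ?nnegrE//; lra.
    have lnK2 : ln (K%:R ^+ 2) = 2 * ln K%:R :> R by rewrite lnXn ?ltr0n// mulr_natl.
    have ln8 : ln (2 ^+ 3) = 3 * ln 2 :> R by rewrite lnXn// mulr_natl.
    have y2w : 0 < y ^+ 2 * w by rewrite mulr_gt0// exprn_gt0.
    have : ln (K%:R ^+ 2) <= ln (2 ^+ 3 * (y ^+ 2 * w)).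
      by rewrite ler_ln// posrE ?mulr_gt0 ?exprn_gt0 ?ltr0n.
    rewrite lnK2 lnM ?posrE ?exprn_gt0// ln8 lnM ?posrE ?exprn_gt0// -/w.
    by rewrite addrA.
  move=> h; have : ln K%:R / ln 2 <= (3 * ln 2 + w + ln w) / (2 * ln 2).
    have l0 : 0 < ln 2 :> R by lra.
    rewrite invfM mulrA ler_pM2r ?invr_gt0// ler_pdivlMr//; lra.
  have -> : (3 * ln 2 + w + ln w) / (2 * ln 2) = 3 / 2 + S ^+ 2 + ln w / (2 * ln 2).
    by rewrite SE; field; lra.
  lra.
(* This is sqrt (S^2 + q) <= S + q / (2 S), where S = sw / b. *)
have sK : Num.sqrt (1 + ln K%:R / ln 2) <=
    S + (5 / 2 + ln w / (2 * ln 2)) * (b / (2 * sw)).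
  set q := 5 / 2 + _.
  have q0 : 0 <= q by rewrite addr_ge0// divr_ge0//; lra.
  apply: (@le_trans _ _ (Num.sqrt (S ^+ 2 + q))); first exact: ler_wsqrtr.
  have t0 : 0 <= q * (b / (2 * sw)) by rewrite mulr_ge0// divr_ge0// mulr_ge0// ltW.
  have Sq0 : 0 <= S + q * (b / (2 * sw)) by rewrite addr_ge0// ltW.
  rewrite -(ger0_norm Sq0) -sqrtr_sqr; apply: ler_wsqrtr.
  rewrite sqrrD (_ : S * (q * (b / (2 * sw))) *+ 2 = q); last first.
    by rewrite /S -mulr_natl; field; apply/andP; split; lra.
  by rewrite lerDl sqr_ge0.
have yK : 2 / b * (y / K%:R) <= (1 / b) / sw.
  have -> : 1 / b / sw = 2 / b * (2 * sw)^-1.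
    by field; rewrite !gt_eqF.
  rewrite ler_pM2l ?divr_gt0// ler_pdivrMr ?ltr0n// ler_pdivlMl ?mulr_gt0//.
  by rewrite mulrAC ltW.
apply: le_lt_trans (lerD sK yK) _.
rewrite -addrA ltrD2l.
have -> : (5 / 2 + ln w / (2 * ln 2)) * (b / (2 * sw)) + 1 / b / sw =
   (5 / 4 * b + ln w / (2 * b) + 1 / b) / sw.
  by rewrite -bb; field; apply/andP; split; lra.
rewrite mulrA ltr_pM2r ?invr_gt0//.
have -> : 5 / 4 * b + ln w / (2 * b) + 1 / b = (5 / 4 * b ^+ 2 + 1 + ln w / 2) / b.
  by field; lra.
(* The margin is thin: beside the terms in ln w it requires 5/4 b + 1/b < 234/100, where 234/100 is
   twice the constant in [v_ge]. Hence the sharp bounds on ln 2. *)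
rewrite ltr_pdivrMr//; nra.
Qed.
End rate_bounds.

(** * Suprema over monotone families *)

Section dense_sequence.
Context {R : realType} {T : Type}.

(* Values isolated on the right are reached as maxima of some {Phi <= b} with b
   rational, the others through a rational interval. *)
Lemma right_dense_sequence (Phi : T -> R) (t0 : T) :
  exists u : nat -> T, forall t (e : R), 0 < e ->
    exists k, Phi t <= Phi (u k) < Phi t + e.
Proof.
pose A (i : rat * rat + rat) : set T := match i with
  | inl ab => [set t | ratr ab.1 < Phi t < ratr ab.2]
  | inr b => [set t | Phi t <= ratr b /\ forall t', Phi t' <= ratr b -> Phi t' <= Phi t]
  end.
have /choice[u uP] : forall k : nat, exists t, forall i,
    unpickle k = Some i -> A i !=set0 -> A i t.
  move=> k; case E : (unpickle k) => [i|]; last by exists t0.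
  have [[t At]|A0] := pselect (A i !=set0).
    by exists t => j [<-].
  by exists t0 => j [<-].
have {}uP i : A i !=set0 -> A i (u (pickle i)) by apply: uP; rewrite pickleK.
exists u => t e e0.
have [[t' /andP[tt' t'e]]|noT] := pselect (exists t', Phi t < Phi t' < Phi t + e).
  have [a] := rat_in_itvoo tt'; rewrite in_itv/= => /andP[ta at'].
  have [b] := rat_in_itvoo t'e; rewrite in_itv/= => /andP[t'b be].
  have /= : A (inl (a, b)) (u (pickle (inl (a, b) : rat * rat + rat))).
    by apply: uP; exists t' => /=; rewrite at' t'b.
  move=> /andP[au ub]; exists (pickle (inl (a, b) : rat * rat + rat)).
  by rewrite (ltW (lt_trans ta au)) (lt_trans ub be).
have [b] := rat_in_itvoo (ltr_pwDr e0 (lexx (Phi t))).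
rewrite in_itv/= => /andP[tb be].
have /= : A (inr b) (u (pickle (inr b : rat * rat + rat))).
  apply: uP; exists t => /=; split; first exact: ltW.
  move=> t' t'b; rewrite leNgt; apply/negP => tt'; apply: noT; exists t'.
  by rewrite tt' (le_lt_trans t'b be).
move=> [ub umax]; exists (pickle (inr b : rat * rat + rat)).
by rewrite umax ?(ltW tb)// (le_lt_trans ub be).
Qed.

End dense_sequence.

Section monotone_deviation.
Context {R : realType} {d} {S : measurableType d} (P : probability S R).
Context {T : Type}.

Definition deviation (G : S -> T -> R) w t := G w t - \int[P]_v G v t.

(* T is preordered by Phi, and G w is monotone for this preorder *)
Record monotone_family (G : S -> T -> R) (Phi : T -> R) (M : R) : Prop := {
  mf_measurable : forall t, measurable_fun setT (G^~ t) ;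
  mf_range : forall w t, 0 <= G w t <= M ;
  mf_mono : forall w t t', Phi t <= Phi t' -> G w t <= G w t' }.

Lemma monotone_family_mean G Phi M : monotone_family G Phi M ->
  forall t, 0 <= \int[P]_w G w t <= M.
Proof.
move=> mG t.
have bG : exists N : R, forall w, `|G w t| <= N.
  by apply: itv_bounded => w; exact: mf_range mG w t.
have mGt := mf_measurable mG t.
apply/andP; split.
  by apply: Rintegral_ge0 => w _; have /andP[] := mf_range mG w t.
rewrite -(prob_Rintegral_cst P M); apply: le_prob_Rintegral => //.
  by exists `|M|.
by move=> w; have /andP[] := mf_range mG w t.
Qed.

(** Finiteness of the family provides the largest index of each nonempty cell. Passing to it does
    not decrease G and raises the mean by at most M / K. The bound is free of m, so that m can
    grow. *)
Lemma finite_deviation_cover (G : S -> T -> R) (Phi : T -> R) (M tau p : R)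
    (m K : nat) (v : 'I_m -> T) :
  monotone_family G Phi M -> 0 < M -> (0 < K)%N -> 0 <= p ->
  (forall t, (P [set w | (tau <= deviation G w t)%R] <= p%:E)%E) ->
  exists B, [/\ measurable B, (P B <= (K%:R * p)%:E)%E &
    forall w k, M / K%:R + tau < deviation G w (v k) -> B w].
Proof.
case: K => // K mG M0 _ p0 tail.
pose g t := \int[P]_w G w t.
have gM t : 0 <= g t <= M by exact: monotone_family_mean mG t.
pose x k := g (v k) * K.+1%:R / M.
(* The minimum puts a mean equal to M into the last cell, so cells are compared with a closed right
   end. *)
pose cell k : 'I_K.+1 := inord (minn K (Num.trunc (x k))).
have x0 k : 0 <= x k.
  by rewrite divr_ge0 ?(ltW M0)// mulr_ge0//; have /andP[] := gM (v k).
have cellx k : (cell k)%:R <= x k <= (cell k)%:R + 1.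
  have /andP[tx xt] := truncn_itv (x0 k).
  rewrite inordK ?ltnS ?geq_minl//; have [Kt|tK] := leqP K (Num.trunc (x k)).
    rewrite (le_trans _ tx) ?ler_nat//= natr1 ler_pdivrMr// mulrC ler_pM2l//.
    by have /andP[] := gM (v k).
  by rewrite tx natr1 ltW.
have cell_diff k k' : cell k = cell k' -> g (v k') - M / K.+1%:R <= g (v k).
  move=> kk'; have /andP[+ _] := cellx k; have /andP[_ +] := cellx k'.
  rewrite kk' => h1 h2; have : x k' <= x k + 1 by apply: le_trans h1 _; rewrite lerD2r.
  have K0 : K.+1%:R != 0 :> R by rewrite pnatr_eq0.
  have KM : M / K.+1%:R * (K.+1%:R / M) = 1 by rewrite mulrA divfK// divff ?gt_eqF.
  rewrite lerBlDr => h3; rewrite -(ler_pM2r (x := K.+1%:R / M)) ?divr_gt0// mulrDl KM.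
  by rewrite !mulrA.
have /choice[U UP] : forall i : 'I_K.+1, exists U : set S,
    [/\ measurable U, (P U <= p%:E)%E &
      forall w k, cell k = i -> M / K.+1%:R + tau < deviation G w (v k) -> U w].
  move=> i; have [[k0 k0i]|nok] := pselect (exists k, cell k = i); last first.
    exists set0; split=> //; last by move=> w k ki; case: nok; exists k.
    by rewrite measure0 lee_fin.
  pose kmax := [arg max_(k > k0 | cell k == i) Phi (v k)]%O.
  have [/eqP kmaxi kmax_max] : cell kmax == i /\
      forall k, cell k == i -> Phi (v k) <= Phi (v kmax).
    by rewrite /kmax; case: arg_maxP => [|j ji jmax]; [exact/eqP|split].
  exists [set w | tau <= deviation G w (v kmax)]; split => //.
    rewrite -[X in measurable X]setTI; apply: measurable_fun_le => //.
    by apply: measurable_funB => //; exact: mf_measurable mG _.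
  move=> w k /eqP ki dev; rewrite /= /deviation -/(g _).
  have {}dev : M / K.+1%:R + tau < G w (v k) - g (v k) by [].
  have Gk := mf_mono mG w (kmax_max k ki).
  have /cell_diff gk : cell k = cell kmax by rewrite kmaxi (eqP ki).
  move: (M / _) (G w _) (g (v kmax)) (g (v k)) dev Gk gk => a b c e; clear.
  by move: (G w _) => f; lra.
pose B := \big[setU/set0]_(i < K.+1) U i.
exists B; split.
- by apply: bigsetU_measurable => i _; have [] := UP i.
- apply: (@le_trans _ _ (\sum_(i < K.+1) P (U i))%E).
    pose U' (i : nat) := U (inord i).
    have -> : B = \big[setU/set0]_(i < K.+1) U' i.
      by apply: eq_bigr => i _; rewrite /U' inord_val.
    rewrite [leRHS](_ : _ = \sum_(i < K.+1) P (U' i))%E.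
      by apply: Boole_inequality => i _; have [] := UP (inord i).
    by apply: eq_bigr => i _; rewrite /U' inord_val.
  apply: (@le_trans _ _ (\sum_(i < K.+1) p%:E)%E).
    by apply: lee_sum => i _; have [] := UP i.
  by rewrite sumEFin sumr_const card_ord mulr_natl.
- move=> w k dev; rewrite /B -bigcup_mkord_ord; exists (cell k) => //=.
  by rewrite inord_val; have [_ _] := UP (cell k); apply; first exact: erefl.
Qed.

(* Exchanges upward and downward deviations, hence the end points of the cells. *)
Lemma deviation_opp (G : S -> T -> R) (Phi : T -> R) (M : R) :
  monotone_family G Phi M ->
  monotone_family (fun w t => M - G w t) (fun t => - Phi t) M /\
  forall w t, deviation (fun w t => M - G w t) w t = - deviation G w t.
Proof.
move=> mG; split.
  split=> [t|w t|w t t'].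
  - by apply: measurable_funB => //; exact: mf_measurable mG t.
  - by have /andP[G0 GM] := mf_range mG w t; rewrite subr_ge0 gerBl GM G0.
  - by rewrite lerN2 lerD2l lerN2 => h; exact: (mf_mono mG w h).
move=> w t; rewrite /deviation RintegralB//.
- rewrite prob_Rintegral_cst; lra.
- by apply: bounded_integrable => //; exists `|M|.
- apply: bounded_integrable; first exact: mf_measurable mG t.
  by apply: itv_bounded => v; exact: mf_range mG v t.
Qed.

Lemma measurable_deviation G Phi M : monotone_family G Phi M ->
  forall t, measurable_fun setT (deviation G ^~ t).
Proof. by move=> mG t; apply: measurable_funB => //; exact: mf_measurable mG t. Qed.

(** The finite bound, applied to G and to M - G, is uniform in the number of indices, so it survives
    the increasing union over the sequence. *)
Lemma monotone_deviation_tail (G : S -> T -> R) (Phi : T -> R) (M tau p : R)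
    (K : nat) (u : nat -> T) :
  monotone_family G Phi M -> 0 < M -> (0 < K)%N -> 0 <= p ->
  (forall t, (P [set w | (tau <= deviation G w t)%R] <= p%:E)%E) ->
  (forall t, (P [set w | (tau <= - deviation G w t)%R] <= p%:E)%E) ->
  (P (\bigcup_k [set w | (M / K%:R + tau < `|deviation G w (u k)|)%R]) <=
   (2 * K%:R * p)%:E)%E.
Proof.
move=> mG M0 K0 p0 up lo.
pose B k := [set w | M / K%:R + tau < `|deviation G w (u k)|].
have mB k : measurable (B k).
  rewrite /B; under eq_set do rewrite -lte_fin.
  rewrite -[X in measurable X]setTI; apply: measurable_lte => //.
  by apply/measurable_EFinP/measurableT_comp => //; exact: measurable_deviation mG _.
have fin m : (P (\big[setU/set0]_(k < m) B k) <= (2 * K%:R * p)%:E)%E.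
  have [mG' devN] := deviation_opp mG.
  pose v (k : 'I_m) := u k.
  have [B1 [mB1 PB1 B1P]] := finite_deviation_cover v mG M0 K0 p0 up.
  have [|B2 [mB2 PB2 B2P]] := finite_deviation_cover (tau := tau) v mG' M0 K0 p0.
    by move=> t; under eq_set do rewrite devN.
  apply: (@le_trans _ _ (P (B1 `|` B2))).
    apply: le_measure; rewrite ?inE//.
    - exact: bigsetU_measurable.
    - exact: measurableU.
    rewrite -bigcup_mkord => w [k /= km]; rewrite /B/= ltr_normr => /orP[h|h].
      by left; apply: (B1P w (Ordinal km)).
    by right; apply: (B2P w (Ordinal km)); rewrite devN.
  rewrite (le_trans (measureU2 P mB1 mB2))//.
  rewrite (_ : 2 * _ * p = K%:R * p + K%:R * p); last by ring.
  by rewrite EFinD leeD.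
have cvgB : P (\big[setU/set0]_(k < m.+1) B k) @[m --> \oo] --> P (\bigcup_k B k).
  rewrite -bigcup_bigsetU_bigcup; apply: nondecreasing_cvg_mu.
  - by move=> m; exact: bigsetU_measurable.
  - by apply: bigcupT_measurable => m; exact: bigsetU_measurable.
  - by move=> m m1 mm1; exact/subsetPset/subset_bigsetU.
rewrite -(cvg_lim _ cvgB)//; apply: lime_le.
  by apply/cvg_ex; exists (P (\bigcup_k B k)).
by apply: nearW => m; exact: fin.
Qed.
End monotone_deviation.

Section sup_deviation.
Context {R : realType} {d} {S : measurableType d} (P : probability S R).
Context {T : Type}.
Variables (G : S -> T -> R) (Phi : T -> R) (M : R).
Hypothesis mG : monotone_family G Phi M.
Hypothesis PhiG : forall t t', Phi t <= Phi t' ->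
  \int[P]_w G w t' - \int[P]_w G w t <= Phi t' - Phi t.
Variable t0 : T.

Local Notation dev := (deviation P G).

(* The event of the theorem is an uncountable union: this is what makes it
   measurable. *)
Lemma deviation_dense_sequence : exists u : nat -> T,
  forall w t (e : R), 0 < e -> exists k, `|dev w t| < `|dev w (u k)| + e.
Proof.
have [u1 u1P] := right_dense_sequence Phi t0.
have [u2 u2P] := right_dense_sequence (fun t => - Phi t) t0.
exists (fun k => if odd k then u1 k./2 else u2 k./2) => w t e e0.
pose g t := \int[P]_v G v t.
have devE t' : dev w t' = G w t' - g t' by [].
(* A nonnegative deviation is approximated from above in [Phi]: G does not decrease, and by [PhiG]
   the mean grows by less than e. A negative one is approximated from below. *)
have [dev0|dev0] := leP 0 (dev w t).
  have [k /andP[k1 k2]] := u1P t e e0; exists k.*2.+1.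
  rewrite /= odd_double uphalf_double /=.
  have Gtu := mf_mono mG w k1; have gtu := PhiG k1.
  rewrite (ger0_norm dev0) -ltrBlDr (lt_le_trans _ (ler_norm _))//.
  rewrite !devE -!/(g _) in dev0 gtu *.
  by move: (G w _) (G w _) (g _) (g _) Gtu gtu => *; lra.
have [k /andP[k1 k2]] := u2P t e e0; exists k.*2.
rewrite odd_double doubleK.
rewrite lerN2 in k1.
have Gtu := mf_mono mG w k1; have gtu := PhiG k1.
have := ler_norm (- dev w (u2 k)); rewrite normrN (ltr0_norm dev0).
move: `|_| => r; rewrite !devE -!/(g _) in gtu *.
by move: (G w _) (G w _) (g _) (g _) Gtu gtu => *; lra.
Qed.

Let supdev w : \bar R := ereal_sup [set (`|dev w t|)%:E | t in [set: T]].

Lemma measurable_sup_deviation : measurable_fun setT supdev.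
Proof.
have [u uP] := deviation_dense_sequence.
have -> : supdev = (fun w => esups (fun k => (`|dev w (u k)|)%:E) 0%N).
  apply/funext => w; apply/eqP; rewrite eq_le; apply/andP; split.
    apply: ge_ereal_sup => _ [t _ <-]; apply/lee_addgt0Pr => e e0.
    have [k kP] := uP w t e e0.
    apply: (@le_trans _ _ (`|dev w (u k)| + e)%:E); first by rewrite lee_fin ltW.
    by rewrite EFinD leeD2r//; apply: ereal_sup_ubound; exists k.
  by apply: le_ereal_sup => _ [k _ <-]; exists (u k).
apply: measurable_fun_esups => k; apply/measurable_EFinP/measurableT_comp => //.
exact: measurable_deviation mG _.
Qed.

Lemma sup_deviation_tail (eta eps : R) : 1 <= M -> 1 < eta -> 0 < eps ->
  (forall (tau : R) t, 0 <= tau ->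
    (P [set w | (tau <= dev w t)%R] <= (expR (- 2 * tau ^+ 2 * eta))%:E)%E) ->
  (forall (tau : R) t, 0 <= tau ->
    (P [set w | (tau <= - dev w t)%R] <= (expR (- 2 * tau ^+ 2 * eta))%:E)%E) ->
  (P [set w | eps%:E <= (Num.sqrt eta / rate (M ^+ 2 * eta))%:E * supdev w] <=
    (2 * expR (- 2 * eps ^+ 2))%:E)%E.
Proof.
move=> M1 eta1 eps0 up lo.
set c := _ / _; set A := [set w | _].
have mA : measurable A.
  rewrite -[X in measurable X]setTI; apply: measurable_lee => //.
  by apply: emeasurable_funM => //; exact: measurable_sup_deviation.
(* Below this threshold the right-hand side is at least 1. *)
have [small|big] := ltP (2 * eps ^+ 2) (ln 2).
  apply: (le_trans (probability_le1 P mA)); rewrite lee_fin.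
  rewrite -[leLHS](@divff _ 2)// ler_pM2l// -[X in X^-1](@lnK R)// ?posrE//.
  by rewrite -expRN ler_expR mulNr lerN2 ltW.
pose y := M * Num.sqrt eta.
have eta0 : 0 < eta by lra.
have se0 : 0 < Num.sqrt eta by rewrite sqrtr_gt0.
have se1 : 1 < Num.sqrt eta by rewrite -sqrtr1 ltr_sqrt.
have y1 : 1 < y by rewrite /y; nra.
have y2 : y ^+ 2 = M ^+ 2 * eta by rewrite exprMn sqr_sqrtr// ltW.
have devM w t : `|dev w t| <= M.
  have /andP[? ?] := mf_range mG w t.
  have /andP[? ?] := monotone_family_mean P mG t.
  by rewrite ler_norml /deviation; apply/andP; split; lra.
(* The supremum need not be attained; the strict inequality r * c < eps is what yields an index
   whose deviation exceeds r. *)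
have Aexists w (r : R) : 0 < c -> A w -> r * c < eps ->
    exists t, r < `|dev w t|.
  move=> c0 Aw rc; apply: contrapT => nodev.
  suff : (supdev w <= r%:E)%E.
    move=> supr; move: rc; rewrite ltNge => /negP; apply.
    rewrite -lee_fin (le_trans Aw)// mulrC [X in (_ <= X)%E]EFinM.
    by rewrite lee_pmul2l// lte_fin.
  apply: ge_ereal_sup => _ [t _ <-]; rewrite lee_fin leNgt.
  by apply/negP => rt; apply: nodev; exists t.
have [yR|[K K0 KR]] := rate_dichotomy y1 eps0 big.
  rewrite y2 in yR.
  have rate0 : 0 < rate (M ^+ 2 * eta).
    by rewrite -(pmulr_rgt0 _ eps0) (lt_trans _ yR)// (lt_trans ltr01).
  have c0 : 0 < c by rewrite divr_gt0.
  rewrite (_ : A = set0) ?measure0 ?lee_fin ?mulr_ge0 ?expR_ge0//.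
  apply/seteqP; split=> // w Aw.
  have [|t] := Aexists w M c0 Aw; first by rewrite mulrA ltr_pdivrMr.
  by rewrite ltNge devM.
rewrite y2 in KR; have K1 : 0 < K%:R :> R by rewrite ltr0n.
have rate0 : 0 < rate (M ^+ 2 * eta).
  rewrite -(pmulr_rgt0 _ eps0) (le_lt_trans _ KR)// addr_ge0 ?sqrtr_ge0//.
  by rewrite divr_ge0// ltW// (lt_trans ltr01).
have c0 : 0 < c by rewrite divr_gt0.
have lnK0 : 0 <= ln K%:R :> R by rewrite ln_ge0// ler1n.
pose q := eps ^+ 2 + ln K%:R / 2.
have q0 : 0 <= q by rewrite addr_ge0 ?sqr_ge0// divr_ge0.
pose tau := Num.sqrt q / Num.sqrt eta.
have tau0 : 0 <= tau by rewrite divr_ge0 ?sqrtr_ge0.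
have tauE : - 2 * tau ^+ 2 * eta = - 2 * q.
  rewrite /tau expr_div_n !sqr_sqrtr// ?(ltW eta0)//.
  by field; rewrite gt_eqF.
have [u uP] := deviation_dense_sequence.
have M0 : 0 < M by lra.
have := monotone_deviation_tail u mG M0 K0 (expR_ge0 _)
  (fun t => up tau t tau0) (fun t => lo tau t tau0).
have -> : 2 * K%:R * expR (- 2 * tau ^+ 2 * eta) = 2 * expR (- 2 * eps ^+ 2).
  have -> : - 2 * tau ^+ 2 * eta = - 2 * eps ^+ 2 + - ln K%:R by rewrite tauE /q; field.
  by rewrite expRD expRN lnK ?posrE//; field; rewrite gt_eqF.
apply: le_trans; apply: le_measure; rewrite ?inE//.
  apply: bigcupT_measurable => k; under eq_set do rewrite -lte_fin.
  rewrite -[X in measurable X]setTI; apply: measurable_lte => //.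
  by apply/measurable_EFinP/measurableT_comp => //; exact: measurable_deviation mG _.
(* Multiplied by sqrt eta, M / K + tau becomes y / K + sqrt q, which [KR] compares with the rate. *)
move=> w Aw; have [|t rt] := Aexists w (M / K%:R + tau) c0 Aw.
  rewrite mulrA ltr_pdivrMr// mulrDl /tau divfK ?gt_eqF//.
  by rewrite addrC mulrAC -/y.
have [|k kP] := uP w t (`|dev w t| - (M / K%:R + tau)); first by rewrite subr_gt0.
by exists k => //=; move: kP; lra.
Qed.

End sup_deviation.

(** * Charges, sample size and the main theorem *)

Section charge_bounds.
Context {R : realType} {d} {T : measurableType d}.
Implicit Types nu mu : {charge set T -> \bar R}.

Lemma abs_charge_le_tv_norm nu A : measurable A -> `|fine (nu A)| <= tv_norm nu.
Proof.
move=> mA; rewrite /tv_norm.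
set nuPN := projT2 _.
have fin B : measurable B -> charge_variation nuPN B \is a fin_num.
  by move=> mB; exact: fin_num_measure.
rewrite -lee_fin fineK; last exact: fin.
rewrite -abse_EFin fineK ?fin_num_measure//.
apply: le_trans (abse_charge_variation nuPN mA) _.
by apply: le_measure; rewrite ?inE.
Qed.

Lemma tv_norm_ge0 nu : 0 <= tv_norm nu.
Proof. exact: le_trans (abs_charge_le_tv_norm nu measurable0). Qed.

Lemma charge_le_fine nu mu A : measurable A -> charge_le nu mu ->
  fine (nu A) <= fine (mu A).
Proof. by move=> mA numu; apply: fine_le; rewrite ?fin_num_measure//; exact: numu. Qed.

Lemma fine_chargeD nu A B : measurable A -> measurable B -> A `<=` B ->
  fine (nu (B `\` A)) = fine (nu B) - fine (nu A).
Proof.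
move=> mA mB AB; rewrite chargeD// (setIidr AB) fineB// fin_num_measure//.
Qed.

End charge_bounds.

Section effective_sample_size.
Context {R : realType} {n : nat} {dZ : 'I_n -> measure_display}.
Context {Z : forall i, measurableType (dZ i)} {Theta : Type}.
Variables (F : prod_space Z -> Theta -> R) (N : R) (t0 : Theta).
Hypothesis FN : forall z t, `|F z t| <= N.

Let c i : R := fine (bounded_difference F i).

Let bounded_differenceE i : bounded_difference F i = (c i)%:E.
Proof.
rewrite fineK// fin_numElt; apply/andP; split.
  apply: (@lt_le_trans _ _ 0%E) => //; apply: ereal_sup_ubound => /=.
  exists t0, ((point : prod_space Z) i), point.
  have -> : dfwith (point : prod_space Z) i ((point : prod_space Z) i) = point.
    apply: functional_extensionality_dep => j.
    by have [<-|ij] := eqVneq i j; rewrite ?dfwithin ?dfwithout.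
  by rewrite subrr normr0.
apply: (@le_lt_trans _ _ (N + N)%:E); last exact: ltry.
apply: ge_ereal_sup => _ [t [x [z ->]]]; rewrite lee_fin.
by rewrite (le_trans (ler_normB _ _))// lerD.
Qed.

(** Since the inverse of 0 is +oo, a finite sample size forces the positive sum of squares by which
    McDiarmid's inequality divides. *)
Lemma effective_sample_sizeP : (0 < effective_sample_size F < +oo)%E ->
  exists c : 'I_n -> R, [/\ forall t, has_bounded_differences (F ^~ t) c,
    0 < \sum_i c i ^+ 2 &
    fine (effective_sample_size F) = (\sum_i c i ^+ 2)^-1].
Proof.
have -> : effective_sample_size F = ((\sum_i c i ^+ 2)%:E^-1)%E.
  rewrite /effective_sample_size -sumEFin; congr (_^-1)%E.
  by apply: eq_bigr => i _; rewrite bounded_differenceE EFin_expe.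
have V0 : 0 <= \sum_i c i ^+ 2 by apply: sumr_ge0 => i _; exact: sqr_ge0.
rewrite inver; case: eqVneq => [_|Vn0 _]; first by rewrite ltxx andbF.
exists c; split => //; last by rewrite lt_neqAle eq_sym Vn0.
move=> t i z y; rewrite -lee_fin -bounded_differenceE.
by apply: ereal_sup_ubound; exists t, (y i), z.
Qed.

End effective_sample_size.

Section mcdiarmid_random_vector.
Context {R : realType} {n : nat} {dZ : 'I_n -> measure_display}.
Context {Z : forall i, measurableType (dZ i)}.
Context {d} {S : measurableType d} (P : probability S R).
Variable X : {RV P >-> prod_space Z}.
Hypothesis indX : independent_components P X.

Lemma distribution_box B : (forall i, measurable (B i)) ->
  distribution P X (box B) =
    (\prod_(i < n) distribution P X [set z : prod_space Z | B i (z i)])%E.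
Proof.
move=> mB; have := indX (J := [set: 'I_n]%SET) (B := B) (fun i _ => mB i).
rewrite (eq_bigl predT); last by move=> i; rewrite inE.
move=> <-; congr (P _); apply/seteqP; split=> w /= XB i; first by move=> _; exact: XB.
by apply: XB; rewrite inE.
Qed.

Lemma mcdiarmid_random_vector (f : prod_space Z -> R) c (tau : R) :
  measurable_fun setT f -> has_bounded_differences f c ->
  0 < \sum_i c i ^+ 2 -> 0 <= tau ->
  (P [set w | (tau <= f (X w) - \int[P]_v f (X v))%R] <=
    (expR (- 2 * tau ^+ 2 / \sum_i c i ^+ 2)%R)%:E)%E.
Proof.
move=> mf fc V0 tau0; have [M fM] := bounded_differences_bounded fc.
have -> : \int[P]_v f (X v) = \int[distribution P X]_z f z.
  rewrite /Rintegral integral_distribution//; first exact/measurable_EFinP.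
  by apply: bounded_integrable; [exact: measurableT_comp|exists M => w].
exact: (mcdiarmid_inequality distribution_box mf fc V0 tau0).
Qed.

End mcdiarmid_random_vector.

(** For nested sets the symmetric difference is a plain difference, so finite additivity gives the
    strict inequality; finiteness allows real values. *)
Lemma content_lt {R : realType} {d} {T : measurableType d}
    (lam : {content set T -> \bar R}) (A B : set T) :
  (lam setT < +oo)%E -> measurable A -> measurable B -> A `<=` B ->
  (0 < lam (A `+` B))%E -> fine (lam A) < fine (lam B).
Proof.
move=> lamT mA mB AB.
have lamfin C : measurable C -> lam C \is a fin_num.
  move=> mC; rewrite ge0_fin_numE//; apply: le_lt_trans lamT.
  by apply: le_measure; rewrite ?inE.
rewrite setY_def (_ : A `\` B = set0) ?set0U; last by apply/seteqP; split=> x //= [/AB].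
move=> lamBA.
have mBA : measurable (B `\` A) by exact: measurableD.
rewrite -lte_fin !fineK ?lamfin//.
have -> : B = A `|` (B `\` A) by rewrite setDUK.
rewrite measureU//; last by rewrite setDIK.
by rewrite lteDl ?lamfin.
Qed.

Theorem corollary2p11 (R : realType)
    (d : measure_display) (Omega : measurableType d)
    (Theta : Type) (E : Theta -> set Omega)
    (n : nat) (dZ : 'I_n -> measure_display)
    (Z : forall i : 'I_n, measurableType (dZ i))
    (mu : prod_space Z -> {charge set Omega -> \bar R})
    (d' : measure_display) (S : measurableType d') (P : probability S R)
    (X : {RV P >-> prod_space Z})
    (nu : {charge set Omega -> \bar R}) :
  let F := fun (z : prod_space Z) (theta : Theta) => fine (mu z (E theta)) in
  [set: Theta] !=set0 ->
  regular_chain R E ->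
  order_bounded_below mu ->
  (forall z, tv_norm (mu z) <= 1) ->
  (forall theta, measurable_fun [set: prod_space Z] (fun z => F z theta)) ->
  independent_components P X ->
  is_charge_inf mu nu ->
  (1 < effective_sample_size F < +oo)%E ->
  let eta : R := fine (effective_sample_size F) in
  forall eps : R, 0 < eps ->
  (P [set w | eps%:E <=
        (Num.sqrt eta / rate ((1 + tv_norm nu) ^+ 2 * eta))%:E *
        ereal_sup [set `|(F (X w) theta)%:E - 'E_P[fun v => F (X v) theta]|
                  | theta in [set: Theta]]]
    <= (2 * expR (- 2 * eps ^+ 2))%:E)%E.
Proof.
move=> F [t0 _] [mE chain [lam [lamT lamE]]] _ mu1 mF indX [nuP _] eta1 eta eps eps0.
have F1 z t : `|F z t| <= 1.
  exact: le_trans (abs_charge_le_tv_norm (mu z) (mE t)) (mu1 z).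
have [|c [Fc V0 etaE]] := effective_sample_sizeP t0 F1.
  by have /andP[e1 ->] := eta1; rewrite (lt_trans lte01 e1).
have eta_gt1 : 1 < eta.
  have /andP[e1 e2] := eta1; rewrite /eta -lte_fin fineK//.
  by rewrite fin_numElt e2 (lt_trans (ltNyr 1) e1).
set M := 1 + tv_norm nu.
have M1 : 1 <= M by rewrite lerDl tv_norm_ge0.
pose G w t := F (X w) t - fine (nu (E t)).
(* lam separates the indices of the chain, so that Phi determines the inclusion
   order; the mean is added so that Phi-close indices have close means *)
pose Phi t := fine (lam (E t)) + \int[P]_w G w t.
have mFX t : measurable_fun setT (fun w => F (X w) t).
  exact: measurableT_comp (mF t) (measurable_funP X).
have iFX t : P.-integrable setT (EFin \o (fun w => F (X w) t)).
  by apply: bounded_integrable => //; exists 1.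
(* The increment is the value of mu_z - nu on [E u] minus [E t], nonnegative because nu is a lower
   bound. *)
have G_le w t u : E t `<=` E u -> G w t <= G w u.
  move=> tu; have mD : measurable (E u `\` E t) by exact: measurableD.
  have := charge_le_fine mD (nuP (X w)).
  rewrite !fine_chargeD// /G /F; lra.
have G0M w t : 0 <= G w t <= M.
  rewrite subr_ge0 (charge_le_fine (mE t) (nuP (X w)))/= /G /M.
  have := F1 (X w) t; have := abs_charge_le_tv_norm nu (mE t).
  by rewrite !ler_norml => /andP[? _] /andP[_ ?]; lra.
have mG t : measurable_fun setT (G ^~ t) by exact: measurable_funB.
have intG t u : E t `<=` E u -> \int[P]_w G w t <= \int[P]_w G w u.
  move=> tu; apply: le_prob_Rintegral => // [||w]; last exact: G_le.
  - by apply: itv_bounded => w; exact: G0M.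
  - by apply: itv_bounded => w; exact: G0M.
have lam_lt t u : E t `<=` E u -> t <> u -> fine (lam (E t)) < fine (lam (E u)).
  by move=> tu /lamE; apply: content_lt.
(* If instead [E u] lay in [E t] with distinct indices, lam would increase strictly and the mean
   weakly from u to t, so that Phi u < Phi t. *)
have PhiE t u : Phi t <= Phi u -> E t `<=` E u.
  move=> tu; have [//|ut] := chain t u.
  have [->//|ne] := pselect (t = u).
  have := lam_lt _ _ ut (fun h => ne (esym h)); have := intG _ _ ut.
  by move: tu; rewrite /Phi; lra.
have famG : monotone_family G Phi M.
  by split => // w t u /PhiE; exact: G_le.
have PhiG t u : Phi t <= Phi u ->
    \int[P]_w G w u - \int[P]_w G w t <= Phi u - Phi t.
  move=> /PhiE tu; suff : fine (lam (E t)) <= fine (lam (E u)) by rewrite /Phi; lra.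
  have [->//|ne] := pselect (t = u).
  exact: ltW (lam_lt _ _ tu ne).
have devE w t : deviation P G w t = F (X w) t - \int[P]_v F (X v) t.
  rewrite /deviation RintegralB//; last first.
    by apply: bounded_integrable => //; exists `|fine (nu (E t))|.
  by rewrite prob_Rintegral_cst /G; lra.
have supE w : ereal_sup [set `|(F (X w) theta)%:E - 'E_P[fun v => F (X v) theta]|%E
      | theta in [set: Theta]] =
    ereal_sup [set (`|deviation P G w theta|)%:E | theta in [set: Theta]].
  congr ereal_sup; apply: eq_imagel => t _; rewrite devE unlock.
  have fin : (\int[P]_v (F (X v) t)%:E)%E \is a fin_num.
    exact: integrable_fin_num (iFX t).
  by rewrite -abse_EFin EFinB /Rintegral (fineK fin).
have etaV (tau : R) : - 2 * tau ^+ 2 * eta = - 2 * tau ^+ 2 / \sum_i c i ^+ 2.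
  by rewrite /eta etaE.
under eq_set do rewrite supE.
apply: (sup_deviation_tail famG PhiG t0) => // tau t tau0; rewrite etaV.
  under eq_set do rewrite devE.
  exact: (mcdiarmid_random_vector indX (mF t) (Fc t)).
(* The lower tail is the upper tail of - F, which has the same bounded differences; the product form
   lets [RintegralZl] apply. *)
pose f z := - 1 * F z t.
have fc : has_bounded_differences f c.
  by move=> i z y; rewrite /f -mulrBr mulN1r normrN; exact: Fc.
have mf : measurable_fun setT f by exact: measurable_funM.
have fE w : f (X w) - \int[P]_v f (X v) = - deviation P G w t.
  by rewrite devE /f RintegralZl//; ring.
by have := mcdiarmid_random_vector indX mf fc V0 tau0; under eq_set do rewrite fE.
Qed.
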